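(* Let $G=(V,E)$ be a connected undirected graph with $V=\{1,\dots,N\}$, $N\ge 2$, let $(\mathcal{M},d)$ be a complete $CAT(0)$ metric space, and let $X_k=(X_v(k))_{v\in V}\in\mathcal{M}^N$, $k\ge 0$, be the sequence generated by the Random Pairwise Midpoint algorithm (defined in the context) from an initial configuration $X_0\in\mathcal{M}^N$. Then there exists $L<0$ such that $$\limsup_{k\to\infty}\frac{\log\mathbb{E}\,\sigma^2(X_k)}{k}\le L .$$
   Context: Graph: $E$ is a set of unordered pairs $\{v,w\}$ of distinct elements of $V$; $v\sim w$ means $\{v,w\}\in E$; $\deg(v)$ is the number of neighbors of $v$. Variance function: for $x=(x_1,\dots,x_N)\in\mathcal{M}^N$, $\sigma^2(x)=\frac1N\sum_{\{v,w\}}d^2(x_v,x_w)$, the sum being over all unordered pairs of distinct elements of $V$. Convention: $\log 0=-\infty$. $CAT(0)$ space: a geodesic in $(\mathcal{M},d)$ is a map $c:[0,l]\to\mathcal{M}$ with $d(c(t),c(t'))=|t-t'|$ for all $t,t'\in[0,l]$; it joins $c(0)$ to $c(l)$. $(\mathcal{M},d)$ is $CAT(0)$ if any two points are joined by a geodesic and for every geodesic triangle with vertices $p,q,r$ (three points and three geodesic segments joining them), every point $x$ on the side from $p$ to $q$ and every point $y$ on the side from $p$ to $r$, one has $d(x,y)\le\|\bar x-\bar y\|$, where $\bar p,\bar q,\bar r$ is a comparison triangle in the Euclidean plane ($\|\bar p-\bar q\|=d(p,q)$, $\|\bar q-\bar r\|=d(q,r)$, $\|\bar r-\bar p\|=d(r,p)$),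 $\bar x\in[\bar p,\bar q]$ satisfies $\|\bar p-\bar x\|=d(p,x)$, and $\bar y\in[\bar p,\bar r]$ satisfies $\|\bar p-\bar y\|=d(p,y)$. In a $CAT(0)$ space any two points $x,y$ have a unique midpoint $\left\langle\frac{x+y}{2}\right\rangle$, i.e. a unique point $m$ with $d(x,m)=d(y,m)=d(x,y)/2$. Random Pairwise Midpoint algorithm: let $(V_k,W_k)_{k\ge 0}$ be i.i.d. random variables with values in $V\times V$ such that $\mathbb{P}[\{V_k,W_k\}=\{v,w\}]=\frac1N\left(\frac1{\deg(v)}+\frac1{\deg(w)}\right)$ if $v\sim w$ and $0$ otherwise, and such that $(V_k,W_k)$ is independent of $X_0,\dots,X_{k-1},(V_0,W_0),\dots,(V_{k-1},W_{k-1})$. The initial configuration $X_0=(X_v(0))_{v\in V}\in\mathcal{M}^N$ is given (deterministic). For each $k\ge1$, set $X_{V_k}(k)=X_{W_k}(k)=\left\langle\frac{X_{V_k}(k-1)+X_{W_k}(k-1)}{2}\right\rangle$ and $X_v(k)=X_v(k-1)$ for $v\notin\{V_k,W_k\}$. *)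

(* Defs.v *)
From HB Require Import structures.
From mathcomp Require Import all_boot all_order all_algebra.
From mathcomp Require Import all_classical all_reals all_analysis.

Set Implicit Arguments.
Unset Strict Implicit.
Unset Printing Implicit Defensive.

Import Order.TTheory GRing.Theory Num.Theory.
Import numFieldNormedType.Exports.

Local Open Scope classical_set_scope.
Local Open Scope ring_scope.

Section cat0_space.
Variable R : realType.

(* The norm that the library puts on 'rV[R]_2 is the sup norm, hence this
   explicit Euclidean distance on the plane. *)
Definition euclid_dist (a b : 'rV[R]_2) : R :=
  Num.sqrt (\sum_(i < 2) (a 0 i - b 0 i) ^+ 2).

Definition segment (a b : 'rV[R]_2) : set 'rV[R]_2 :=
  [set (1 - t) *: a + t *: b | t in `[0, 1]].

Variable M : metricType R.

(* Only the restriction of c to [0, l] matters. *)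
Definition geodesic (l : R) (c : R -> M) (p q : M) : Prop :=
  [/\ 0 <= l, c 0 = p, c l = q &
      forall s t : R, s \in `[0, l] -> t \in `[0, l] ->
        mdist (c s) (c t) = `|s - t|].

(* The comparison triangle pb qb rb and the comparison points xb, yb are
   universally quantified: a comparison triangle always exists and is unique
   up to an isometry of the plane. *)
Definition cat0 : Prop :=
  (forall p q : M, exists l c, geodesic l c p q) /\
  (forall (p q r : M) (lpq lqr lpr : R) (cpq cqr cpr : R -> M),
     geodesic lpq cpq p q -> geodesic lqr cqr q r -> geodesic lpr cpr p r ->
   forall pb qb rb : 'rV[R]_2,
     euclid_dist pb qb = mdist p q -> euclid_dist qb rb = mdist q r ->
     euclid_dist rb pb = mdist r p ->
   forall x y : M,
     [set cpq s | s in `[0, lpq]] x -> [set cpr t | t in `[0, lpr]] y ->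
   forall xb yb : 'rV[R]_2,
     segment pb qb xb -> euclid_dist pb xb = mdist p x ->
     segment pb rb yb -> euclid_dist pb yb = mdist p y ->
   mdist x y <= euclid_dist xb yb).

(* The library's completeType asks for a distinguished point, which a metric
   space does not have; cauchy is the library's notion. *)
Definition complete_space : Prop :=
  forall u : nat -> M, cauchy (u @ \oo) -> exists l : M, u @ \oo --> l.

Definition is_midpoint (x y m : M) : Prop :=
  mdist x m = mdist x y / 2 /\ mdist y m = mdist x y / 2.

(* The default value x is never used in a CAT(0) space, where is_midpoint x y
   holds of exactly one point. *)
Definition midpoint (x y : M) : M := xget x [set m | is_midpoint x y m].

Definition sigma2 (N : nat) (x : 'I_N -> M) : R :=
  N%:R^-1 * \sum_(v < N) \sum_(w < N | (v < w)%N) mdist (x v) (x w) ^+ 2.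

Definition rpm_step (N : nat) (vw : 'I_N * 'I_N) (x : 'I_N -> M) : 'I_N -> M :=
  fun u => if (u == vw.1) || (u == vw.2) then midpoint (x vw.1) (x vw.2)
           else x u.

(* Step k uses the pair of index k, so the pair of index 0 is never used. *)
Fixpoint rpm (N : nat) (T : Type) (X0 : 'I_N -> M)
    (VW : nat -> T -> 'I_N * 'I_N) (k : nat) (t : T) : 'I_N -> M :=
  if k is j.+1 then rpm_step (VW k t) (rpm X0 VW j t) else X0.

End cat0_space.

Definition degree (N : nat) (e : rel 'I_N) (v : 'I_N) : nat := #|[pred w | e v w]|.

Section random_pairs.
Context (d : measure_display) (T : measurableType d) (R : realType).
Variable P : probability T R.

(* Every subset of the value type U is regarded as measurable: U is finite in
   the use below. *)
Definition mutually_independent (U : Type) (Y : nat -> T -> U) : Prop :=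
  forall (s : seq nat) (A : nat -> set U), uniq s ->
    P (\bigcap_(k in [set` s]) (Y k @^-1` A k)) =
    (\prod_(k <- s) P (Y k @^-1` A k))%E.

Definition identically_distributed (U : Type) (Y : nat -> T -> U) : Prop :=
  forall j k (A : set U), P (Y j @^-1` A) = P (Y k @^-1` A).

(* The law is prescribed on unordered pairs only; the order of the two
   components of VW k is free. *)
Record rpm_pairs (N : nat) (e : rel 'I_N) (VW : nat -> T -> 'I_N * 'I_N) :
    Prop := RpmPairs {
  rpm_pairs_measurable : forall k (A : set ('I_N * 'I_N)),
    measurable (VW k @^-1` A) ;
  rpm_pairs_indep : mutually_independent VW ;
  rpm_pairs_ident : identically_distributed VW ;
  rpm_pairs_law : forall k (v w : 'I_N),
    P [set t | [set (VW k t).1; (VW k t).2] = [set v; w]] =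
    (if e v w then
       N%:R^-1 * ((degree e v)%:R^-1 + (degree e w)%:R^-1)
     else 0)%:E
}.

End random_pairs.

(* Main.v *)
Require Import Defs.
From mathcomp Require Import all_boot all_order all_algebra.
From mathcomp Require Import all_classical all_reals all_analysis.
From mathcomp Require Import measurable_realfun ring lra.

(** In a CAT(0) space the Bruhat-Tits inequality
    d(r, m)^2 <= (d(r, p)^2 + d(r, q)^2) / 2 - d(p, q)^2 / 4,
    m the midpoint of p and q, shows that replacing x_v and x_w by their
    midpoint lowers sigma2 by at least d(x_v, x_w)^2 / 2.  Every edge is drawn
    with probability at least 2 / N^2, and the triangle inequality along paths
    bounds all distances in terms of those along edges; hence one step
    multiplies the mean of sigma2 by at most 1 - N^-5, from any configuration.
    Independence of the steps then gives geometric decay. *)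

Set Implicit Arguments.
Unset Strict Implicit.
Unset Printing Implicit Defensive.

Import Order.TTheory GRing.Theory Num.Theory.
Import numFieldNormedType.Exports.

Local Open Scope classical_set_scope.
Local Open Scope ring_scope.

(** * Coordinates in the comparison plane *)

Section plane.
Variable R : realType.

Definition plane_pt (x y : R) : 'rV[R]_2 := \row_j (if j == 0 then x else y).

Lemma euclid_dist_pt (x y x' y' : R) :
  euclid_dist (plane_pt x y) (plane_pt x' y') =
  Num.sqrt ((x - x') ^+ 2 + (y - y') ^+ 2).
Proof. by rewrite /euclid_dist !big_ord_recl big_ord0 !mxE /= addr0. Qed.

End plane.

(** * Midpoints and the Bruhat-Tits inequality *)

Section midpoints.
Variables (R : realType) (M : metricType R).
Hypothesis M_cat0 : cat0 M.
Implicit Types (p q r m : M) (c : R -> M) (l : R).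

Lemma geodesic_length l c p q : geodesic l c p q -> l = mdist p q.
Proof.
case=> l0 <- <- ->; last 2 first.
- by rewrite in_itv /= lexx.
- by rewrite in_itv /= lexx l0.
by rewrite sub0r normrN ger0_norm.
Qed.

(** Taking [y] to be the vertex [r] itself, the comparison bounds the distance by a Euclidean
    median, whose length is the right-hand side. *)
Lemma CN_geodesic l c p q r : geodesic l c p q ->
  mdist r (c (l / 2)) ^+ 2 <=
    (mdist r p ^+ 2 + mdist r q ^+ 2) / 2 - mdist p q ^+ 2 / 4.
Proof.
move=> gc; have lE := geodesic_length gc.
have [l0 c0 cl dc] := gc.
(* Treated apart because the abscissa [X] below divides by [l]. *)
have [l_eq0|l_neq0] := eqVneq l 0.
  have pq : p = q by apply: mdist_positivity; rewrite -lE.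
  by rewrite l_eq0 mul0r c0 -pq mdistxx; lra.
have l_gt0 : 0 < l by rewrite lt_neqAle eq_sym l_neq0.
have [lqr [cqr gqr]] := M_cat0.1 q r.
have [lpr [cpr gpr]] := M_cat0.1 p r.
have lprE := geodesic_length gpr.
set b := mdist p r in lprE; set e := mdist q r.
have b0 : 0 <= b := mdist_ge0 _ _.
have e0 : 0 <= e := mdist_ge0 _ _.
have t1 : l <= b + e by rewrite lE /e (metric_sym q) metric_triangle.
have t2 : b <= l + e by rewrite lE metric_triangle.
have t3 : e <= l + b by rewrite lE (metric_sym p q) metric_triangle.
(* The comparison triangle is (0, 0), (l, 0), (X, Y), with X given by the law
   of cosines. *)
pose X := (b ^+ 2 + l ^+ 2 - e ^+ 2) / (2 * l).
have XE : X * (2 * l) = b ^+ 2 + l ^+ 2 - e ^+ 2.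
  by rewrite /X divfK// mulf_neq0// pnatr_eq0.
(* The apex exists: as in Heron's formula, the difference of squares splits into four factors,
   nonnegative by the triangle inequalities. *)
have Y0 : 0 <= b ^+ 2 - X ^+ 2.
  have : (X * (2 * l)) ^+ 2 <= (b * (2 * l)) ^+ 2.
    rewrite XE -subr_ge0.
    have -> : (b * (2 * l)) ^+ 2 - (b ^+ 2 + l ^+ 2 - e ^+ 2) ^+ 2 =
      ((b + l - e) * (b + l + e)) * ((e - (b - l)) * (e + (b - l))) by ring.
    by rewrite !mulr_ge0//; lra.
  by rewrite (exprMn _ X) (exprMn _ b) ler_pM2r ?subr_ge0// exprn_gt0// mulr_gt0.
pose Y := Num.sqrt (b ^+ 2 - X ^+ 2).
have YE : Y ^+ 2 = b ^+ 2 - X ^+ 2 by rewrite sqr_sqrtr.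
have half_in : l / 2 \in `[0, l] by rewrite in_itv /=; apply/andP; split; lra.
have dpm : mdist p (c (l / 2)) = l / 2.
  by rewrite -{1}c0 dc// ?in_itv/= ?lexx// sub0r normrN ger0_norm//; lra.
have main := M_cat0.2 p q r l lqr lpr c cqr cpr gc gqr gpr
  (plane_pt 0 0) (plane_pt l 0) (plane_pt X Y).
have := main _ _ _ (c (l / 2)) r _ _ (plane_pt (l / 2) 0) (plane_pt X Y).
have -> : euclid_dist (plane_pt 0 0) (plane_pt l 0) = mdist p q.
  by rewrite euclid_dist_pt subrr expr0n addr0 sub0r sqrrN sqrtr_sqr gtr0_norm.
have -> : euclid_dist (plane_pt l 0) (plane_pt X Y) = mdist q r.
  rewrite euclid_dist_pt sub0r sqrrN YE.
  have -> : (l - X) ^+ 2 + (b ^+ 2 - X ^+ 2) = e ^+ 2 by move: XE; lra.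
  by rewrite sqrtr_sqr ger0_norm.
have -> : euclid_dist (plane_pt X Y) (plane_pt 0 0) = mdist r p.
  rewrite euclid_dist_pt !subr0 YE addrC subrK sqrtr_sqr ger0_norm//.
  exact: metric_sym.
have -> : euclid_dist (plane_pt 0 0) (plane_pt (l / 2) 0) = mdist p (c (l / 2)).
  rewrite euclid_dist_pt subrr expr0n addr0 sub0r sqrrN sqrtr_sqr dpm.
  by rewrite ger0_norm; lra.
have -> : euclid_dist (plane_pt 0 0) (plane_pt X Y) = mdist p r.
  rewrite euclid_dist_pt !sub0r !sqrrN YE addrC subrK sqrtr_sqr ger0_norm//.
move=> /(_ erefl erefl erefl).
have im1 : [set c s | s in `[0, l]] (c (l / 2)) by exists (l / 2).
have im2 : [set cpr t | t in `[0, lpr]] r.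
  by case: gpr => ? _ <- _; exists lpr => //=; rewrite in_itv/= lexx andbT.
have sg1 : segment (plane_pt 0 0) (plane_pt l 0) (plane_pt (l / 2) 0).
  exists (1 / 2); first by rewrite /= in_itv/=; lra.
  by apply/rowP => j; rewrite !mxE; case: ifP => _; lra.
have sg2 : segment (plane_pt 0 0) (plane_pt X Y) (plane_pt X Y).
  exists 1; first by rewrite /= in_itv/= ler01 lexx.
  by apply/rowP => j; rewrite !mxE; case: ifP => _; lra.
move=> /(_ im1 im2 sg1 erefl sg2 erefl) le_d.
rewrite (metric_sym r (c _)) (metric_sym r p) (metric_sym r q) -/b -/e -lE.
apply: (le_trans (_ : _ <= euclid_dist (plane_pt (l / 2) 0) (plane_pt X Y) ^+ 2)).
  by rewrite ler_sqr// nnegrE ?mdist_ge0// /euclid_dist sqrtr_ge0.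
rewrite euclid_dist_pt sqr_sqrtr ?addr_ge0 ?sqr_ge0// sub0r sqrrN YE.
move: XE; lra.
Qed.

Lemma geodesic_half l c p q : geodesic l c p q -> is_midpoint p q (c (l / 2)).
Proof.
move=> gc; have lE := geodesic_length gc; have [l0 c0 cl dc] := gc.
have half_in : l / 2 \in `[0, l] by rewrite in_itv /=; apply/andP; split; lra.
rewrite /is_midpoint -lE -{1}c0 -{1}cl !dc ?in_itv/= ?lexx ?l0//; split.
  by rewrite sub0r normrN ger0_norm; lra.
by rewrite ger0_norm; lra.
Qed.

Lemma CN_midpoint p q r :
  mdist r (midpoint p q) ^+ 2 <=
    (mdist r p ^+ 2 + mdist r q ^+ 2) / 2 - mdist p q ^+ 2 / 4.
Proof.
have [l [c gc]] := M_cat0.1 p q.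
suff -> : midpoint p q = c (l / 2) by exact: CN_geodesic.
rewrite /midpoint; case: xgetP => [m _ [pm qm]|/(_ (c (l / 2)))]; last first.
  by case; exact: geodesic_half.
(* Uniqueness of midpoints: at [r := m] the right side of the inequality vanishes. *)
apply: mdist_positivity; apply/eqP; rewrite -sqrf_eq0 eq_le sqr_ge0 andbT.
rewrite (le_trans (CN_geodesic m gc))// (metric_sym m p) (metric_sym m q) pm qm.
lra.
Qed.

End midpoints.

(** * Contraction of the variance in one step *)

Section variance.
Variables (R : realType) (M : metricType R) (N : nat).
Implicit Types (x : 'I_N -> M) (p : 'I_N * 'I_N) (z : M).

Lemma sigma2_ge0 x : 0 <= sigma2 x.
Proof.
rewrite mulr_ge0 ?invr_ge0 ?ler0n//; apply: sumr_ge0 => v _.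
by apply: sumr_ge0 => w _; exact: sqr_ge0.
Qed.

Lemma sigma2_double_sum x :
  sigma2 x = (2 * N%:R)^-1 * \sum_v \sum_w mdist (x v) (x w) ^+ 2.
Proof.
rewrite /sigma2.
pose S := \sum_(v < N) \sum_(w < N | (v < w)%N) mdist (x v) (x w) ^+ 2.
rewrite -/S.
suff -> : \sum_v \sum_w mdist (x v) (x w) ^+ 2 = S + S.
  by rewrite invfM; lra.
have SE : S = \sum_(v < N) \sum_(w < N)
    (if (v < w)%N then mdist (x v) (x w) ^+ 2 else 0).
  by apply: eq_bigr => v _; rewrite big_mkcond.
rewrite {2}SE [in RHS]exchange_big SE -big_split /=; apply: eq_bigr => v _.
rewrite -big_split /=; apply: eq_bigr => w _.
have [_|_|/val_inj ->] := ltngtP v w; rewrite ?addr0 ?add0r//.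
  by rewrite metric_sym.
by rewrite mdistxx expr0n.
Qed.

Lemma mdist_path (e : rel 'I_N) x (delta : R) :
  (forall v w, e v w -> mdist (x v) (x w) <= delta) ->
  forall s v, path e v s -> mdist (x v) (x (last v s)) <= (size s)%:R * delta.
Proof.
move=> edge; elim=> [|w s IH] v /=; first by rewrite mdistxx mul0r.
case/andP => /edge vw /IH ws; rewrite (le_trans (metric_triangle _ (x w) _))//.
by rewrite -natr1 mulrDl mul1r addrC lerD.
Qed.

(** Paths without repeated vertices have at most [N] edges, so every distance is at most [N] times
    [Num.sqrt D]. The double sum has [N ^ 2] terms and prefactor [1 / (2 N)]. *)
Lemma sigma2_le_edges (e : rel 'I_N) x (D : R) :
  (forall v w : 'I_N, connect e v w) ->
  (forall v w, e v w -> mdist (x v) (x w) ^+ 2 <= D) -> 0 <= D ->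
  sigma2 x <= N%:R ^+ 3 / 2 * D.
Proof.
move=> e_conn edge D0.
have dist_le v w : mdist (x v) (x w) ^+ 2 <= N%:R ^+ 2 * D.
  have /connectP[s0 /shortenP[s sp s_uniq _] ->] := e_conn v w.
  have /(mdist_path (x := x) (delta := Num.sqrt D)) : path e v s by [].
  have size_s : (size s <= N)%N.
    have := max_card (mem (v :: s)).
    by rewrite card_ord (card_uniqP s_uniq) => /ltnW.
  have edge' v' w' : e v' w' -> mdist (x v') (x w') <= Num.sqrt D.
    by move/edge/ler_wsqrtr; rewrite sqrtr_sqr ger0_norm// mdist_ge0.
  move=> /(_ edge') le_d.
  rewrite -[D]sqr_sqrtr// -exprMn ler_sqr ?nnegrE ?mdist_ge0//.
  by rewrite (le_trans le_d)// ler_wpM2r ?sqrtr_ge0// ler_nat.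
case: (posnP N) => [N0|N_gt0].
  rewrite sigma2_double_sum big1; last first.
    by case=> i i_lt; exfalso; rewrite N0 in i_lt.
  by rewrite mulr0 !mulr_ge0 ?exprn_ge0 ?invr_ge0.
have NN : N%:R != 0 :> R by rewrite pnatr_eq0 -lt0n.
rewrite sigma2_double_sum.
have -> : N%:R ^+ 3 / 2 * D =
    (2 * N%:R)^-1 * \sum_(v < N) \sum_(w < N) (N%:R ^+ 2 * D).
  rewrite !sumr_const !card_ord -[_ *+ N *+ N]mulr_natl -[_ * D *+ N]mulr_natl.
  by move: NN; move: (N%:R : R) => n n0; field.
rewrite ler_wpM2l ?invr_ge0 ?mulr_ge0//.
by apply: ler_sum => v _; apply: ler_sum => w _.
Qed.

Hypothesis M_cat0 : cat0 M.

(** Diagonal pairs have probability zero, but treating them lets the one-step bound hold for every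
    pair, with no null set to discard. *)
Lemma rpm_step_diag v x : rpm_step (v, v) x = x.
Proof.
apply/funext => u; rewrite /rpm_step /= orbb; case: eqP => // ->.
apply: mdist_positivity; apply/eqP; rewrite -sqrf_eq0 eq_le sqr_ge0 andbT.
rewrite metric_sym (le_trans (CN_midpoint M_cat0 _ _ _))// mdistxx; lra.
Qed.

(** Only two terms change, and each is bounded by the midpoint inequality seen from [z]. *)
Lemma sum_sqr_mdist_step p x z : p.1 != p.2 ->
  \sum_v mdist z (rpm_step p x v) ^+ 2 <=
  \sum_v mdist z (x v) ^+ 2 - mdist (x p.1) (x p.2) ^+ 2 / 2.
Proof.
case: p => a b /= ab; rewrite (bigD1 a)//= (bigD1 b) 1?eq_sym//=.
rewrite [in leRHS](bigD1 a)//= [in leRHS](bigD1 b) 1?eq_sym//=.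
rewrite {1 2}/rpm_step /= !eqxx orbT /=.
have rest_le : \sum_(u < N | (u != a) && (u != b))
      mdist z (rpm_step (a, b) x u) ^+ 2 <=
    \sum_(u < N | (u != a) && (u != b)) mdist z (x u) ^+ 2.
  apply: ler_sum => u /andP[/negbTE ua /negbTE ub].
  by rewrite /rpm_step /= ua ub.
by have := CN_midpoint M_cat0 (x a) (x b) z; lra.
Qed.

(** The previous bound is summed twice, with [z] running over the new configuration and then over
    the old one. Each pass lowers the double sum by [N * D / 2], and the prefactor is
    [1 / (2 N)]. *)
Lemma sigma2_step p x : (0 < N)%N ->
  sigma2 (rpm_step p x) <= sigma2 x - mdist (x p.1) (x p.2) ^+ 2 / 2.
Proof.
move=> N_gt0; have [|ab] := eqVneq p.1 p.2.
  by case: p => a b /= ->; rewrite rpm_step_diag mdistxx expr0n mul0r subr0.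
set D := mdist (x p.1) (x p.2) ^+ 2.
have N0 : 0 < N%:R :> R by rewrite ltr0n.
have sumD : \sum_(v < N) (D / 2) = N%:R * D / 2.
  by rewrite sumr_const card_ord -[LHS]mulr_natl mulrA.
rewrite !sigma2_double_sum.
have -> : D / 2 = (2 * N%:R)^-1 * (N%:R * D).
  by move: (N%:R : R) N0 => n n0; field; rewrite gt_eqF.
rewrite -mulrBr ler_wpM2l ?invr_ge0 ?mulr_ge0//.
have le1 := ler_sum (index_enum 'I_N) (P := xpredT)
  (fun u _ => sum_sqr_mdist_step x (rpm_step p x u) ab).
rewrite (le_trans le1)// sumrB sumD exchange_big /=.
under eq_bigr do under eq_bigr do rewrite metric_sym.
have le2 := ler_sum (index_enum 'I_N) (P := xpredT)
  (fun u _ => sum_sqr_mdist_step x (x u) ab).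
move: le2; rewrite sumrB sumD /=; lra.
Qed.

Lemma sigma2_mean_step (e : rel 'I_N) (q : 'I_N * 'I_N -> R) x :
  (0 < N)%N -> irreflexive e -> (forall v w : 'I_N, connect e v w) ->
  (forall p, 0 <= q p) -> \sum_p q p = 1 ->
  (forall v w, e v w -> 2 / N%:R ^+ 2 <= q (v, w) + q (w, v)) ->
  \sum_p q p * sigma2 (rpm_step p x) <= (1 - N%:R ^- 5) * sigma2 x.
Proof.
move=> N_gt0 e_irr e_conn q0 q1 q_edge.
have N0 : 0 < N%:R :> R by rewrite ltr0n.
pose D := \sum_p q p * mdist (x p.1) (x p.2) ^+ 2.
have D0 : 0 <= D by rewrite sumr_ge0// => p _; rewrite mulr_ge0 ?sqr_ge0.
(* The two orderings of an edge are distinct summands of [D], of total weight at least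
   [2 / N ^ 2]. *)
have edge v w : e v w -> mdist (x v) (x w) ^+ 2 <= N%:R ^+ 2 / 2 * D.
  move=> vw.
  have vw_neq : (w, v) != (v, w).
    by apply: contraTneq vw => -[->] _; rewrite e_irr.
  rewrite mulrC -ler_pdivrMr; last by rewrite divr_gt0// exprn_gt0.
  rewrite invf_div mulrC (le_trans (ler_wpM2r (sqr_ge0 _) (q_edge _ _ vw)))//.
  rewrite /D (bigD1 (v, w))//= (bigD1 (w, v))//= mulrDl addrA (metric_sym (x w)).
  by rewrite lerDl sumr_ge0// => p _; rewrite mulr_ge0 ?sqr_ge0.
have := sigma2_le_edges e_conn edge.
rewrite mulr_ge0 ?divr_ge0 ?exprn_ge0// => /(_ isT) le_sD.
apply: (@le_trans _ _ (sigma2 x - D / 2)).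
  have -> : sigma2 x - D / 2 =
      \sum_p q p * (sigma2 x - mdist (x p.1) (x p.2) ^+ 2 / 2).
    under eq_bigr do rewrite mulrBr.
    rewrite sumrB -mulr_suml q1 mul1r /D mulr_suml; congr (_ - _).
    by apply: eq_bigr => p _; rewrite -mulrA.
  by apply: ler_sum => p _; rewrite ler_wpM2l// sigma2_step.
rewrite mulrBl mul1r lerD2l lerN2 -ler_pdivlMl ?invr_gt0 ?exprn_gt0// invrK.
(* The bounds give [sigma2 x <= N ^ 5 / 4 * D], which leaves a factor 2 to spare. *)
have -> : N%:R ^+ 5 * (D / 2) = N%:R ^+ 3 / 2 * (N%:R ^+ 2 / 2 * D) * 2 by lra.
by have := sigma2_ge0 x; lra.
Qed.

End variance.

(** * Mean decay under independent random maps *)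

Definition iterate (T U S : Type) (Y : nat -> T -> U) (step : S -> U -> S)
    (x : S) (j k : nat) (t : T) : S :=
  foldl step x [seq Y i t | i <- iota j k].

Section iterated_random_maps.
Context (d : measure_display) (T : measurableType d) (R : realType).
Variables (P : probability T R) (U : finType) (S : Type).
Variables (Y : nat -> T -> U) (step : S -> U -> S) (f : S -> R).
Hypothesis Y_meas : forall k (A : set U), measurable (Y k @^-1` A).
Hypothesis Y_indep : mutually_independent P Y.
Hypothesis Y_ident : identically_distributed P Y.
Hypothesis f_ge0 : forall x, 0 <= f x.

Let q (p : U) : R := fine (P (Y 0%N @^-1` [set p])).

Let probE k p : P (Y k @^-1` [set p]) = (q p)%:E.
Proof. by rewrite fineK ?fin_num_measure// (Y_ident k 0%N). Qed.

Let g x j k : T -> \bar R := fun t => (f (iterate Y step x j k t))%:E.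

(** Conditioning on the first draw: on each event [Y j = p] the first map is deterministic, and the
    rest starts from [step x p] at time [j.+1]. *)
Lemma iterateS x j k :
  g x j k.+1 =
  (fun t => \sum_p (g (step x p) j.+1 k \_ (Y j @^-1` [set p])) t)%E.
Proof.
apply/funext => t; rewrite (bigD1 (Y j t))//= big1 => [|p pY].
  by rewrite adde0 patchE mem_set.
by rewrite patchE memNset// => /= E; rewrite E eqxx in pY.
Qed.

(** [S] carries no sigma-algebra; measurability comes from the finitely many values of each draw. *)
Lemma measurable_iterate x j k : measurable_fun setT (g x j k).
Proof.
elim: k x j => [|k IH] x j; first exact: (@measurable_cst _ _ _ _ _ (f x)%:E).
rewrite iterateS; apply: emeasurable_sum => p _.
by apply/(measurable_restrictT _ _).1 => //; exact: measurable_funTS.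
Qed.

(* The event constrains only the Y i with i < j, so it is independent of the
   maps applied from time j on: this replaces conditioning on the past. *)
Lemma iterate_mean_decay (r : R) : 0 <= r ->
  (forall x, \sum_p q p * f (step x p) <= r * f x) ->
  forall k j x (s : seq nat) (A : nat -> set U), uniq s -> all (ltn^~ j) s ->
    (\int[P]_(t in \bigcap_(i in [set` s]) (Y i @^-1` A i)) g x j k t
      <= (r ^+ k * f x)%:E * P (\bigcap_(i in [set` s]) (Y i @^-1` A i)))%E.
Proof.
move=> r0 decay; elim=> [|k IH] j x s A s_uniq s_lt;
  set B := \bigcap_(i in _) _.
all: have mB : measurable B by apply: fin_bigcap_measurable => // i _.
  by rewrite expr0 mul1r -integral_cst.
rewrite iterateS ge0_integral_sum//; last 2 first.
- move=> p; apply/(measurable_restrict _ _ _).1 => //.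
  by apply: measurable_funS (measurable_iterate _ _ _).
- by move=> p t _; rewrite patchE; case: ifP => // _; rewrite lee_fin.
(* The constraint [Y j = p] joins the event. As [j] is not in [s], independence factors it out, and
   all indices stay below [j.+1] for the induction hypothesis. *)
pose A' p i := if i == j then [set p] else A i.
have jNs : j \notin s.
  by apply/negP => /(allP s_lt) /=; rewrite ltnn.
have A'E p : \bigcap_(i in [set` j :: s]) (Y i @^-1` A' p i) =
    B `&` Y j @^-1` [set p].
  apply/seteqP; split => [t At|t [Bt Yt] i /=].
    split; last by have := At j; rewrite /= inE eqxx /A' eqxx; exact.
    move=> i /= si; have := At i; rewrite /= inE si orbT /A'.
    by case: eqP => [ij|_]; [rewrite -ij si in jNs|exact].
  by rewrite inE /A'; case: eqP => [-> //|_ /=]; exact: Bt.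
have PA' p : P (B `&` Y j @^-1` [set p]) = (P B * (q p)%:E)%E.
  rewrite -A'E Y_indep /= ?jNs// big_cons {1}/A' eqxx probE muleC.
  congr (_ * _)%E.
  rewrite [P B]Y_indep//; apply: eq_big_seq => i si; rewrite /A'.
  by case: eqP => // ij; rewrite -ij si in jNs.
apply: (@le_trans _ _ (\sum_p (r ^+ k * f (step x p))%:E * (P B * (q p)%:E))%E).
  apply: lee_sum => p _; rewrite -integral_mkcondr -PA' -A'E.
  apply: IH => /=; first by rewrite jNs.
  by rewrite ltnSn; apply: sub_all s_lt => i /ltnW.
rewrite -(@fineK _ (P B)) ?fin_num_measure//.
under eq_bigr do rewrite -!EFinM.
rewrite sumEFin -EFinM lee_fin.
have -> : \sum_p r ^+ k * f (step x p) * (fine (P B) * q p) =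
    r ^+ k * fine (P B) * \sum_p q p * f (step x p).
  by rewrite mulr_sumr; apply: eq_bigr => p _; ring.
have -> : r ^+ k.+1 * f x * fine (P B) = r ^+ k * fine (P B) * (r * f x).
  by rewrite exprS; ring.
by rewrite ler_wpM2l// mulr_ge0 ?exprn_ge0// fine_ge0.
Qed.

Lemma expectation_iterate_le (r : R) (x : S) (j k : nat) : 0 <= r ->
  (forall x, \sum_p q p * f (step x p) <= r * f x) ->
  ('E_P[fun t => f (iterate Y step x j k t)] <= (r ^+ k * f x)%:E)%E.
Proof.
(* With no constraint the event is the whole space. *)
move=> r0 decay; have := iterate_mean_decay r0 decay k (j := j) x (s := [::])
  (fun=> setT) isT isT.
by rewrite unlock set_nil bigcap_set0 probability_setT mule1.
Qed.

End iterated_random_maps.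

(** * Law of the drawn pairs *)

Lemma sum_probability_preimage1 (d : measure_display) (T : measurableType d)
    (R : realType) (P : probability T R) (U : finType) (Y : T -> U) :
  (forall A : set U, measurable (Y @^-1` A)) ->
  \sum_p fine (P (Y @^-1` [set p])) = 1.
Proof.
move=> Y_meas; apply: EFin_inj; rewrite -sumEFin.
under eq_bigr do rewrite fineK ?fin_num_measure//.
rewrite -(@probability_setT _ _ _ P).
rewrite (_ : [set: T] = \bigcup_(p in [set: U]) (Y @^-1` [set p])); last first.
  by apply/seteqP; split => // t _; exists (Y t).
rewrite measure_fin_bigcup//; last 2 first.
- exact: finite_finset.
- by move=> p p' _ _ [t [/= <- <-]].
have all_in p : [set: U] p -> p \notin index_enum U ->
    P (Y @^-1` [set p]) = 0%E by rewrite mem_index_enum.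
rewrite (fsbigE _ _ (index_enum_uniq U) _ all_in)//.
by apply: eq_bigl => p; rewrite in_setT.
Qed.

Lemma set2_eq_pair (I : Type) (a b v w : I) :
  [set a; b] = [set v; w] <-> (a, b) = (v, w) \/ (a, b) = (w, v).
Proof.
split=> [E|[[-> ->]//|[-> ->]]]; last by rewrite setUC.
have [av|aw] : [set v; w] a by rewrite -E; left.
  rewrite av in E *; have [bv|->] : [set v; w] b by rewrite -E; right.
    by have : [set v; b] w; [rewrite E; right|rewrite bv => -[] ->; left].
  by left.
rewrite aw in E *; have [->|bw] : [set v; w] b by rewrite -E; right.
  by right.
by have : [set w; b] v; [rewrite E; left|rewrite bw => -[] ->; left].
Qed.

(** [rpm] unfolds from its last step, whereas the independence induction peels off the first. The
    start is 1 because step [k] uses the pair of index [k]. *)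
Lemma rpm_iterate (R : realType) (M : metricType R) (N : nat) (T : Type)
    (X0 : 'I_N -> M) (VW : nat -> T -> 'I_N * 'I_N) (k : nat) (t : T) :
  rpm X0 VW k t = iterate VW (fun x p => rpm_step p x) X0 1 k t.
Proof.
elim: k => [//|k IH].
rewrite [LHS]/= IH /iterate -(addn1 k) iotaD map_cat foldl_cat /=.
by rewrite add1n addn1.
Qed.

Section pair_law.
Context (d : measure_display) (T : measurableType d) (R : realType).
Variables (P : probability T R) (N : nat) (e : rel 'I_N).
Variable VW : nat -> T -> 'I_N * 'I_N.
Hypotheses (e_sym : symmetric e) (e_irr : irreflexive e).
Hypothesis hVW : rpm_pairs P e VW.

(** The two ordered events are disjoint by irreflexivity and their union has the prescribed
    probability; degrees lie between 1 and [N]. *)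
Lemma rpm_pairs_edge_ge v w : e v w ->
  2 / N%:R ^+ 2 <= fine (P (VW 0%N @^-1` [set (v, w)])) +
                   fine (P (VW 0%N @^-1` [set (w, v)])).
Proof.
move=> vw; have mY p : measurable (VW 0%N @^-1` [set p]).
  exact: rpm_pairs_measurable hVW _ _.
rewrite -fineD ?fin_num_measure// -measureU//; last first.
  apply/seteqP; split => // t [/= -> [vw_eq _]].
  by rewrite vw_eq e_irr in vw.
rewrite (_ : _ `|` _ =
    [set t | [set (VW 0%N t).1; (VW 0%N t).2] = [set v; w]]); last first.
  by apply/seteqP; split => t /=; rewrite set2_eq_pair -surjective_pairing.
rewrite [X in fine X](rpm_pairs_law hVW) vw /= -[2]/(1 + 1) mulrDl expr2 invfM mul1r.
rewrite mulrDr; have degree_ge v' w' : e v' w' ->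
    (N%:R^-1 : R) <= (degree e v')%:R^-1.
  move=> vw'; have deg_gt0 : (0 < degree e v')%N.
    by apply/card_gt0P; exists w'.
  have := max_card (mem [pred w | e v' w]); rewrite card_ord => deg_le.
  by rewrite lef_pV2 ?posrE ?ltr0n ?ler_nat// (leq_trans deg_gt0).
by apply: lerD; rewrite ler_wpM2l ?invr_ge0//;
  [exact: degree_ge vw|apply: (@degree_ge _ v); rewrite e_sym].
Qed.

End pair_law.

(* The bound ln r also holds; halving it absorbs the constant C from a finite
   rank on, with no limit to take. *)
Lemma limn_esup_lne_geometric (R : realType) (u : nat -> \bar R) (r C : R) :
  0 < r < 1 -> (forall k, (u k <= (r ^+ k * C)%:E)%E) ->
  (limn_esup (fun k => lne (u k) / (k%:R)%:E) <= (ln r / 2)%:E)%E.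
Proof.
move=> /andP[r0 r1] u_le.
have lnr : ln r < 0 by rewrite ln_lt0// r0 r1.
(* Adding 1 keeps [ln D] meaningful when [C] is zero, as for a constant initial configuration. *)
pose D := `|C| + 1; have D0 : 0 < D by rewrite ltr_wpDl.
have lne_le k : (lne (u k) <= (k%:R * ln r + ln D)%:E)%E.
  have rD0 : 0 < r ^+ k * D by rewrite mulr_gt0// exprn_gt0.
  have [u0|u0] := leP (u k) 0%E; first by rewrite le0_lneNy ?leNye.
  have -> : (k%:R * ln r + ln D)%:E = lne (r ^+ k * D)%:E.
    by rewrite lne_EFin// lnM ?posrE ?exprn_gt0// lnXn// mulr_natl.
  rewrite lee_lne ?in_itv/= ?leey ?andbT ?lee_fin ?(ltW rD0) ?(ltW u0)//.
  rewrite (le_trans (u_le k))// lee_fin ler_wpM2l ?exprn_ge0 ?(ltW r0)//.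
  by rewrite /D (le_trans (ler_norm C))// lerDl.
(* From rank [n] on, [ln D] is at most [k * (- ln r / 2)]. Being a successor, [n] also keeps the
   division by [k = 0] out of the tail. *)
pose n := (Num.truncn (`|ln D| * (2 / - ln r))).+1.
have n_ge : ln D <= n%:R * (- ln r / 2).
  rewrite -ler_pdivrMr ?divr_gt0 ?oppr_gt0// invf_div.
  apply: (@le_trans _ _ (`|ln D| * (2 / - ln r))).
    by rewrite ler_wpM2r ?ler_norm// divr_ge0// oppr_ge0 ltW.
  by rewrite ltW// /n truncnS_gt.
rewrite /limn_esup /limf_esup; apply: (@le_trans _ _
  (ereal_sup [set lne (u k) / (k%:R)%:E | k in [set k | (n <= k)%N]])%E).
  by apply: ereal_inf_lbound; exists [set k | (n <= k)%N] => //; exists n.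
apply: ge_ereal_sup => _ [k /= nk <-].
have k0 : 0 < k%:R :> R by rewrite ltr0n (leq_trans _ nk).
rewrite inver gt_eqF// lee_pdivrMr//.
rewrite (le_trans (lne_le k))// lee_fin.
have : n%:R * (- ln r / 2) <= k%:R * (- ln r / 2).
  by rewrite ler_wpM2r ?ler_nat// divr_ge0// oppr_ge0 ltW.
by move: n_ge; lra.
Qed.

Theorem theorem2 (R : realType) (N : nat) (hN : (2 <= N)%N)
    (e : rel 'I_N) (e_sym : symmetric e) (e_irr : irreflexive e)
    (e_conn : forall v w : 'I_N, connect e v w)
    (M : metricType R) (M_complete : complete_space M) (M_cat0 : cat0 M)
    (d : measure_display) (T : measurableType d) (P : probability T R)
    (VW : nat -> T -> 'I_N * 'I_N) (hVW : rpm_pairs P e VW)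
    (X0 : 'I_N -> M) :
  exists2 L : R, L < 0 &
    (limn_esup (fun k : nat =>
       lne ('E_P[fun t => sigma2 (rpm X0 VW k t)]) / (k%:R)%:E)
     <= L%:E)%E.
Proof.
(* The one-step contraction factor; [2 <= N] puts it strictly between 0 and 1, so that
   [ln r < 0]. *)
pose r : R := 1 - N%:R ^- 5.
have N_gt1 : 1 < N%:R ^+ 5 :> R by rewrite exprn_egt1// ltr1n.
have r01 : 0 < r < 1.
  rewrite /r subr_gt0 invf_lt1 ?N_gt1 ?(lt_trans ltr01)//=.
  by rewrite gtrBl invr_gt0 (lt_trans ltr01).
exists (ln r / 2); first by rewrite pmulr_llt0 ?invr_gt0// ln_lt0.
apply: (limn_esup_lne_geometric (C := sigma2 X0) r01) => k.
under eq_fun do rewrite rpm_iterate.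
have [r0 _] := andP r01.
apply: expectation_iterate_le; last 2 first.
- exact: ltW.
- move=> x; apply: (sigma2_mean_step M_cat0 _ (ltnW hN) e_irr e_conn) => [p||].
  + exact: fine_ge0.
  + exact: (sum_probability_preimage1 _ (rpm_pairs_measurable hVW 0)).
  + by move=> v w vw; exact: rpm_pairs_edge_ge hVW _ _ vw.
- exact: rpm_pairs_measurable hVW.
- exact: rpm_pairs_indep hVW.
- exact: rpm_pairs_ident hVW.
- exact: sigma2_ge0.
Qed.
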